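(* Let $k\ge 0$ and $\delta\ge k+2$ be integers, and let $n$ be sufficiently large (i.e. $n\ge n_0(k,\delta)$ for some $n_0$ depending only on $k$ and $\delta$). If $G$ is an $n$-vertex graph with minimum degree $\delta(G)\ge\delta$ and $$\lambda(G)\ge n-\delta+k-1,$$ then $G$ is $k$-edge-Hamiltonian unless $G=H_{n,k,\delta}$ or $G=L_{n,k,\delta}$.
   Context: All graphs are finite and simple; equality of graphs means isomorphism. $\lambda(G)$ denotes the spectral radius of $G$, i.e. the largest eigenvalue of the adjacency matrix $A(G)$. $K_s$ is the complete graph on $s$ vertices, $I_t$ is the edgeless graph on $t$ vertices, $G\cup H$ is the disjoint union, and $G\vee H$ is the join (obtained from $G\cup H$ by adding all edges between $G$ and $H$). A Hamilton cycle is a cycle through all vertices. A graph $G$ is $k$-edge-Hamiltonian if any collection of vertex-disjoint paths in $G$ with at most $k$ edges altogether is contained in a Hamilton cycle of $G$ (so $0$-edge-Hamiltonian means Hamiltonian). Define $$H_{n,k,\delta}:=K_\delta\vee(K_{n-2\delta+k}\cup I_{\delta-k}),\qquad L_{n,k,\delta}:=K_{k+1}\vee(K_{n-\delta-1}\cup K_{\delta-k}).$$ *)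

(* Defs.v *)
From HB Require Import structures.
From mathcomp Require Import all_boot all_order all_algebra.
From mathcomp Require Import classical_sets reals.

Set Implicit Arguments.
Unset Strict Implicit.
Unset Printing Implicit Defensive.

Import Order.TTheory GRing.Theory Num.Theory.

Local Open Scope ring_scope.

Record sgraph := SGraph {
  vertex :> finType;
  adj : rel vertex;
  adj_sym : symmetric adj;
  adj_irrefl : irreflexive adj
}.

Definition graph_iso (G H : sgraph) : Prop :=
  exists2 f : G -> H, bijective f & forall x y, adj (f x) (f y) = adj x y.

Section Constructions.

Definition complete_rel (s : nat) : rel 'I_s := fun x y => x != y.

Lemma complete_rel_sym s : symmetric (@complete_rel s).
Proof. by move=> x y; rewrite /complete_rel eq_sym. Qed.

Lemma complete_rel_irrefl s : irreflexive (@complete_rel s).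
Proof. by move=> x; rewrite /complete_rel eqxx. Qed.

Definition complete (s : nat) : sgraph :=
  SGraph (@complete_rel_sym s) (@complete_rel_irrefl s).

Definition edgeless_rel (t : nat) : rel 'I_t := fun _ _ => false.

Lemma edgeless_rel_sym t : symmetric (@edgeless_rel t).
Proof. by []. Qed.

Lemma edgeless_rel_irrefl t : irreflexive (@edgeless_rel t).
Proof. by []. Qed.

Definition edgeless (t : nat) : sgraph :=
  SGraph (@edgeless_rel_sym t) (@edgeless_rel_irrefl t).

Variables G H : sgraph.

(* [b] decides whether the edges between [G] and [H] are present. *)
Definition sum_rel (b : bool) : rel (G + H)%type := fun u v =>
  match u, v with
  | inl x, inl y => adj x y
  | inr x, inr y => adj x y
  | _, _ => b
  end.

Lemma sum_rel_sym b : symmetric (sum_rel b).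
Proof. by move=> [x|x] [y|y] //=; rewrite adj_sym. Qed.

Lemma sum_rel_irrefl b : irreflexive (sum_rel b).
Proof. by move=> [x|x] /=; rewrite adj_irrefl. Qed.

Definition disjoint_union : sgraph :=
  SGraph (@sum_rel_sym false) (@sum_rel_irrefl false).

Definition join : sgraph :=
  SGraph (@sum_rel_sym true) (@sum_rel_irrefl true).

End Constructions.

(* Writing [n + k - 2 * d] for n - 2d + k keeps the truncated subtraction exact
   as soon as n + k >= 2d. *)
Definition H_graph (n k d : nat) : sgraph :=
  join (complete d)
       (disjoint_union (complete (n + k - 2 * d)) (edgeless (d - k))).

Definition L_graph (n k d : nat) : sgraph :=
  join (complete k.+1)
       (disjoint_union (complete (n - d - 1)) (complete (d - k))).

Definition degree (G : sgraph) (x : G) : nat := #|[set y : G | adj x y]|.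

(* Degrees are smaller than [#|G|], so the initial value [#|G|] is irrelevant
   for a nonempty graph. *)
Definition min_degree (G : sgraph) : nat :=
  \big[minn/#|G|]_(x : G) degree x.

Definition adjmx (R : realType) (G : sgraph) : 'M[R]_#|G| :=
  \matrix_(i, j) (adj (enum_val i) (enum_val j))%:R.

(* For a nonempty graph the set of eigenvalues is finite and, the matrix being
   symmetric, nonempty, so this supremum is the largest eigenvalue. *)
Definition spectral_radius (R : realType) (G : sgraph) : R :=
  sup [set a : R | eigenvalue (adjmx R G) a]%classic.

Section Hamiltonicity.

Variable G : sgraph.

Definition hamilton_cycle (c : seq G) : bool :=
  [&& (2 < size c)%N, cycle (@adj G) c, uniq c & [forall x, x \in c]].

Definition cycle_edges (c : seq G) : {set {set G}} :=
  [set [set x; next c x] | x in c].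

(* A path is given by its nonempty sequence of vertices; distinctness of the
   vertices is imposed in [path_system] below. *)
Definition walk (p : seq G) : bool := (p != [::]) && sorted (@adj G) p.

Definition path_edges (p : seq G) : seq {set G} :=
  [seq [set e.1; e.2] | e <- zip p (behead p)].

(* [uniq (flatten P)] says both that no member of [P] repeats a vertex and that
   distinct members are vertex-disjoint. *)
Definition path_system (P : seq (seq G)) : bool :=
  all walk P && uniq (flatten P).

Definition nb_edges (P : seq (seq G)) : nat :=
  (\sum_(p <- P) (size p).-1)%N.

End Hamiltonicity.

(* Only edges are compared: a Hamilton cycle contains every vertex. *)
Definition edge_hamiltonian (k : nat) (G : sgraph) : Prop :=
  forall P : seq (seq G), path_system P -> (nb_edges P <= k)%N ->
  exists2 c : seq G, hamilton_cycle c &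
    forall p, p \in P -> {subset path_edges p <= cycle_edges c}.

(* Main.v *)
Require Import Defs.
From mathcomp Require Import classical_sets boolp reals.
From mathcomp Require Import all_boot all_order all_algebra.
From mathcomp Require Import zify ring lra.

(* Let [s = d - k], and let [M] be the edge set of a path system with at most
   [k] edges that lies on no Hamilton cycle.  Add edges to [G] as long as no
   Hamilton cycle through [M] appears.  In the resulting graph [G'],
   nonadjacent vertices are joined by a Hamilton path through [M], and Posa's
   crossing argument for a nonadjacent pair of maximal degree sum yields
   [i >= d] with [2 i < n + k] such that at least [i - k] vertices have degree
   at most [i].
   The spectral radius is bounded by the Collatz-Wielandt inequality
   ([A y < c y] with [y > 0] forces every eigenvalue below [c]) with explicit
   vectors [y]: the hypothesis on the spectral radius forces [i = d], giving a
   set [S] of [s] vertices of degree exactly [d], and forces the complement of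
   [S] to be a clique.  Hence [G' = G].
   By Ore's condition, all vertices outside [S] with a neighbour in [S] are
   joined to all of [S], so that the graph induced on [S] is regular.  For [u]
   in [S] and [v] outside [S] without neighbours in [S], the degree sum is the
   largest that Ore's condition allows, which determines the Hamilton paths
   through [M] from [u] to [v] so tightly that rotations of them show [S] to be
   independent (the graph [H]) or a clique (the graph [L]). *)

Set Implicit Arguments.
Unset Strict Implicit.
Unset Printing Implicit Defensive.

(** * Hamilton paths through prescribed edges *)

Section ConsecutivePairs.
Variable V : finType.
Implicit Types (p q : seq V) (E : {set V}).

(* Convertible to [path_edges], but independent of a graph structure on [V]. *)
Definition pedges p : seq {set V} :=
  [seq [set e.1; e.2] | e <- zip p (behead p)].

Lemma pedges_cat p a q :
  pedges (p ++ a :: q) = pedges (rcons p a) ++ pedges (a :: q).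
Proof.
elim: p => [|x p IH] //.
by case: p IH => [|y p] //= IH; rewrite /pedges /= -/(pedges _) -[in RHS]cat1s -[LHS]cat1s; congr (_ ++ _).
Qed.

Lemma pedges_cons a b q : pedges (a :: b :: q) = [set a; b] :: pedges (b :: q).
Proof. by []. Qed.

Lemma pedges_rcons p a b :
  pedges (rcons (rcons p a) b) = rcons (pedges (rcons p a)) [set a; b].
Proof. by rewrite -cats1 cat_rcons pedges_cat pedges_cons cats1. Qed.

Lemma mem_pedges_split p a b q E :
  (E \in pedges (p ++ a :: b :: q)) =
  [|| E == [set a; b], E \in pedges (rcons p a) | E \in pedges (b :: q)].
Proof. by rewrite pedges_cat mem_cat pedges_cons in_cons; do !case: (_ \in _) => //=; rewrite ?orbT. Qed.

Lemma pedges_rev p : pedges (rev p) = rev (pedges p).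
Proof.
elim: p => [|x [|y p] IH] //.
rewrite pedges_cons rev_cons [in RHS]rev_cons -IH rev_cons pedges_rcons.
by rewrite setUC.
Qed.

Lemma mem_pedges_rev p E : (E \in pedges (rev p)) = (E \in pedges p).
Proof. by rewrite pedges_rev mem_rev. Qed.

Lemma mem_pedges_catl p q E : E \in pedges p -> E \in pedges (p ++ q).
Proof.
case: q => [|a q]; first by rewrite cats0.
case/lastP: p => // p b; rewrite cat_rcons mem_pedges_split => ->.
by rewrite orbT.
Qed.

Lemma mem_pedges_catr p q E : E \in pedges q -> E \in pedges (p ++ q).
Proof. by move=> H; rewrite -mem_pedges_rev rev_cat mem_pedges_catl ?mem_pedges_rev. Qed.

Lemma pedgesP p E :
  E \in pedges p -> exists p1 a b p2, p = p1 ++ a :: b :: p2 /\ E = [set a; b].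
Proof.
elim: p => [|x [|y p] IH] //; rewrite pedges_cons in_cons => /orP[/eqP->|/IH].
  by exists [::], x, y, p.
by move=> [p1 [a [b [p2 [-> ->]]]]]; exists (x :: p1), a, b, p2.
Qed.

Lemma set2_eqP (a b x y : V) :
  [set a; b] = [set x; y] -> a = x /\ b = y \/ a = y /\ b = x.
Proof.
move=> H.
have: a \in [set x; y] by rewrite -H set21.
have: b \in [set x; y] by rewrite -H set22.
have: x \in [set a; b] by rewrite H set21.
have: y \in [set a; b] by rewrite H set22.
by rewrite !inE => /orP[]/eqP-> /orP[]/eqP-> /orP[]/eqP ? /orP[]/eqP ?; subst; auto.
Qed.

End ConsecutivePairs.

Section HamiltonPaths.
Variables (V : finType) (e : rel V) (M : {set {set V}}).
Hypothesis esym : symmetric e.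
Implicit Types (p q : seq V) (u v w x y a b : V).

Definition ham_path p : Prop :=
  [/\ sorted e p, uniq p, forall x, x \in p & {subset M <= pedges p}].

(** The start is repeated at the end so that the closing edge is among the [pedges]. One edge walked
    back and forth qualifies on two vertices, so larger graphs are needed to get a genuine cycle. *)
Definition ham_cycle : Prop :=
  exists x q, [/\ path e x (rcons q x), uniq (x :: q), forall y, y \in x :: q
                & {subset M <= pedges (x :: rcons q x)}].

Lemma ham_path_close u q : ham_path (u :: q) -> e (last u q) u -> ham_cycle.
Proof.
move=> [P U A S] eL; exists u, q; split=> //; first by rewrite rcons_path eL andbT.
by move=> E /S; rewrite -rcons_cons -cats1 => /mem_pedges_catl.
Qed.

Lemma ham_path_perm p q : ham_path p -> perm_eq p q -> sorted e q ->
  (forall E, E \in M -> E \in pedges p -> E \in pedges q) -> ham_path q.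
Proof.
move=> [P U A S] pq Sq H; split=> //.
- by rewrite -(perm_uniq pq).
- by move=> x; rewrite -(perm_mem pq).
- by move=> E EM; apply/H/S.
Qed.

Lemma sorted_split p a b q :
  sorted e (p ++ a :: b :: q) = [&& sorted e (rcons p a), e a b & path e b q].
Proof. by case: p => //= x p; rewrite cat_path rcons_path /= andbA. Qed.

Lemma sorted_esym p : sorted e (rev p) = sorted e p.
Proof. by rewrite rev_sorted; apply: eq_sorted => x y; rewrite esym. Qed.

(** Posa rotation: the segment up to [a] is reversed and reattached by the edge [u b]. Only [a b] is
    lost, and it is not in [M]. *)
Lemma ham_path_rotate u p a b q :
  ham_path (u :: p ++ a :: b :: q) -> e u b -> [set a; b] \notin M ->
  ham_path (a :: rev p ++ u :: b :: q).
Proof.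
move=> H eub abM; apply: (ham_path_perm H).
- apply/permP => f; rewrite /= !count_cat /= count_rev; lia.
- case: H => + _ _ _; rewrite -cat_cons sorted_split => /and3P[S1 _ S2].
  rewrite -cat_cons sorted_split eub S2 !andbT.
  by rewrite -[rcons _ _]/(a :: rcons _ u) -rev_cons -rev_rcons sorted_esym.
- move=> E EM; rewrite -!cat_cons !mem_pedges_split.
  rewrite -[rcons (a :: _) u]/(a :: rcons _ u) -rev_cons -rev_rcons mem_pedges_rev.
  case/or3P => [/eqP EE|->|->]; rewrite ?orbT //.
  by rewrite -EE EM in abM.
Qed.

Hypothesis nocyc : ~ ham_cycle.

(** Rotating at [u b] gives a Hamilton path from [a] with the same last vertex, and the edge between
    its ends would close it unless [a b] had to be kept. *)
Lemma ham_path_cross u q p1 a b p2 : ham_path (u :: q) ->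
  u :: q = p1 ++ a :: b :: p2 -> e u b -> e (last u q) a -> [set a; b] \in M.
Proof.
move=> H E eub eva; apply/negPn/negP => abM; case: p1 E => [|x p1] [].
  by move=> ua _; apply: nocyc; apply: ham_path_close H _; rewrite [X in e _ X]ua.
move=> _ E; move: H eva; rewrite E => H.
rewrite last_cat /= => eva; apply: nocyc.
have := ham_path_rotate H eub abM => /ham_path_close; apply.
by rewrite last_cat.
Qed.

End HamiltonPaths.

(** * Degree sums of the ends of a Hamilton path *)

Section NextInPath.
Variable V : eqType.
Implicit Types (p q : seq V).

Lemma next_split p a b q :
  uniq (p ++ a :: b :: q) -> next (p ++ a :: b :: q) a = b.
Proof. by move=> U; rewrite -(next_rot (size p)) // rot_size_cat /= eqxx. Qed.

Lemma next_last u q : uniq (u :: q) -> next (u :: q) (last u q) = u.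
Proof.
case/lastP: q => [|q v] U; first by rewrite /= eqxx.
by rewrite -(next_rot (size (u :: q))) // last_rcons -rcons_cons -cats1 rot_size_cat /= eqxx.
Qed.

Lemma split_at_nonlast u q x : x \in u :: q -> x != last u q ->
  exists p1 b p2, u :: q = p1 ++ x :: b :: p2.
Proof.
rewrite -[last u q]/(last u (u :: q)); move: (u :: q) => p.
case/splitPr => p1 [|b p2]; first by rewrite last_cat /= eqxx.
by exists p1, b, p2.
Qed.

Lemma split_neq_last u q p1 a b p2 : uniq (u :: q) ->
  u :: q = p1 ++ a :: b :: p2 -> a != last u q.
Proof.
move=> U E; have := next_split; move/(_ p1 a b p2); rewrite -E => /(_ U) nab.
apply/eqP => al; have := next_last U; rewrite -al nab => bu.
move: U; rewrite E bu; case: p1 E => [|x p1] [ux _]; first by rewrite -ux /= inE eqxx.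
by rewrite cat_uniq /= ux !inE eqxx ?orbT /= ?andbF.
Qed.

End NextInPath.

Section Counting.
Variables (V : finType) (e : rel V) (M : {set {set V}}) (k : nat).
Hypothesis esym : symmetric e.
Hypothesis eirr : irreflexive e.
Hypothesis cardM : #|M| <= k.
Hypothesis nocyc : ~ ham_cycle e M.
Implicit Types (p q : seq V) (u v w x y a b : V).

Definition deg u := #|[set x | e u x]|.

Section OnePath.
Variables (u : V) (q : seq V).
Hypothesis Hp : ham_path e M (u :: q).
Let v := last u q.
(** [next] is cyclic, so [nx v = u]. This makes [nx] a bijection, and irreflexivity keeps [v] out of
    both [A] and [B]. *)
Let nx := next (u :: q).
Let A := [set x | e u (nx x)].
Let B := [set x | e v x].
Let MM := [set x | (x != v) && ([set x; nx x] \in M)].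

Let U : uniq (u :: q). Proof. by case: Hp. Qed.
Let inp x : x \in u :: q. Proof. by case: Hp. Qed.

Let nx_inj : injective nx. Proof. exact: can_inj (prev_next U). Qed.

Lemma card_next_neighbours : #|A| = deg u.
Proof.
rewrite /deg -(card_imset _ nx_inj); apply: eq_card => y; rewrite !inE.
apply/imsetP/idP => [[x]|euy]; first by rewrite inE => H ->.
by exists (prev (u :: q) y); rewrite ?inE /nx next_prev.
Qed.

(** Away from [v], [nx] raises the position on the path by one, so no two vertices succeed each
    other and the pairs [{x, nx x}] are distinct members of [M]. *)
Let MM_le : #|MM| <= k.
Proof.
apply: leq_trans cardM.
have inj : {in MM &, injective (fun x => [set x; nx x])}.
  move=> x y; rewrite !inE => /andP[xv _] /andP[yv _] /set2_eqP[[]//|[xy yx]].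
  have key z : z != v -> index (nx z) (u :: q) = (index z (u :: q)).+1.
    move=> zv; have [p1 [b [p2 E]]] := split_at_nonlast (inp z) zv.
    have Uz := U; rewrite /nx E in Uz *; rewrite next_split //.
    move: Uz; rewrite cat_uniq /= !inE !negb_or => /and3P[_ /and3P[zp bp _] /andP[/andP[zb _] _]].
    by rewrite !index_cat (negbTE zp) (negbTE bp) /= eqxx (negbTE zb) eqxx; lia.
  by have := key _ xv; have := key _ yv; rewrite -xy yx; lia.
rewrite -(card_in_imset inj); apply/subset_leq_card/fintype.subsetP => E /imsetP[x].
by rewrite inE => /andP[_ H ->].
Qed.

Let AIB_sub : A :&: B \subset MM.
Proof.
apply/fintype.subsetP => x; rewrite !inE => /andP[ux vx].
have xv : x != v by apply: contraTneq vx => ->; rewrite eirr.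
rewrite xv /=; have [p1 [b [p2 E]]] := split_at_nonlast (inp x) xv.
move: ux; have Ex : nx x = b by rewrite /nx E next_split // -E.
by rewrite Ex => ub; apply: (ham_path_cross esym nocyc Hp E).
Qed.

Let AUB_sub : A :|: B \subset ~: [set v].
Proof.
apply/fintype.subsetP => x; rewrite !inE; apply: contraTneq => ->.
by rewrite /nx next_last // !eirr.
Qed.

Let card_v : #|~: [set v]| = #|V|.-1.
Proof. by have := cardsC [set v]; rewrite cards1; lia. Qed.

(** The degree sum is [#|A :|: B| + #|A :&: B|]; the union misses [v], and each vertex of the
    intersection is a crossing, hence yields an edge of [M]. *)
Lemma ham_path_ore : deg u + deg v <= #|V|.-1 + k.
Proof.
rewrite -card_next_neighbours -(cardsUI A B).
apply: leq_add; last exact: leq_trans (subset_leq_card AIB_sub) MM_le.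
by rewrite -card_v subset_leq_card.
Qed.

(** Equality in the Ore bound turns [A :|: B] into the complement of [v] and [A :&: B] into [MM];
    the conclusion tests both identities at [a]. *)
Lemma ham_path_tight p1 a b p2 : #|V|.-1 + k <= deg u + deg v ->
  u :: q = p1 ++ a :: b :: p2 ->
  (e u b || e v a) /\ ([set a; b] \in M) = e u b && e v a.
Proof.
rewrite -card_next_neighbours -[deg v]/#|B| -(cardsUI A B) => H E.
have av : a != v by apply: split_neq_last E.
have nab : nx a = b by rewrite /nx E next_split // -E.
have h1 := subset_leq_card AUB_sub; rewrite card_v in h1.
have h2 := subset_leq_card AIB_sub.
have E1 : A :|: B = ~: [set v].
  by apply/eqP; rewrite eqEcard AUB_sub card_v; have := MM_le; lia.
have E2 : A :&: B = MM.
  by apply/eqP; rewrite eqEcard AIB_sub; have := MM_le; lia.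
split.
  by move/setP: E1 => /(_ a); rewrite !inE nab av.
by move/setP: E2 => /(_ a); rewrite !inE nab av.
Qed.

Lemma ham_path_nonadj : deg u - k <= #|[set x | (x != v) && ~~ e v x]|.
Proof.
rewrite -card_next_neighbours -(cardsID B A).
have h2 := leq_trans (subset_leq_card AIB_sub) MM_le.
suff : #|A :\: B| <= #|[set x | (x != v) && ~~ e v x]| by lia.
apply/subset_leq_card/fintype.subsetP => x; rewrite !inE => /andP[-> ux]; rewrite andbT.
have : x \in ~: [set v] by apply: (fintype.subsetP AUB_sub); rewrite !inE ux.
by rewrite !inE.
Qed.

End OnePath.

Section Saturated.
Hypothesis complete_cycle : (forall x y, x != y -> e x y) -> ham_cycle e M.
Hypothesis sat : forall u v, u != v -> ~~ e u v ->
  exists2 q, ham_path e M (u :: q) & last u q = v.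

Lemma saturated_ore u v : u != v -> ~~ e u v -> deg u + deg v <= #|V|.-1 + k.
Proof. by move=> uv nuv; have [q H <-] := sat uv nuv; exact: ham_path_ore. Qed.

(** The index [i] is [deg u], for [u] the end of smaller degree in a nonadjacent pair of maximal
    degree sum. By maximality all non-neighbours of the other end have degree at most [i], and a
    Hamilton path between the ends supplies enough of them. *)
Lemma saturated_posa : exists i,
  [/\ exists u, deg u = i, i + i < #|V| + k & i - k <= #|[set x | deg x <= i]|].
Proof.
pose P (z : V * V) := (z.1 != z.2) && ~~ e z.1 z.2.
have [z0 Pz0] : exists z, P z.
  apply: contrapT => H; apply: nocyc; apply: complete_cycle => x y xy.
  by apply/negPn/negP => nxy; apply: H; exists (x, y); rewrite /P xy nxy.
case: (@arg_maxnP _ z0 P (fun z => deg z.1 + deg z.2) Pz0) => -[u0 v0] Pz zmax.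
have [u [v [uv nuv duv zm]]] : exists u v, [/\ u != v, ~~ e u v, deg u <= deg v &
    forall x, x != v -> ~~ e x v -> deg x <= deg u].
  move: Pz => /andP[/= uv nuv]; have [h|h] := leqP (deg u0) (deg v0).
    exists u0, v0; split=> // x xv nxv.
    by have := zmax (x, v0); rewrite /P /= xv nxv => /(_ isT); lia.
  exists v0, u0; rewrite eq_sym esym (ltnW h); split=> // x xv nxv.
  by have := zmax (x, u0); rewrite /P /= xv nxv => /(_ isT); lia.
exists (deg u); split; first by exists u.
  by have : 0 < #|V| by [apply/card_gt0P; exists u]; have := saturated_ore uv nuv; lia.
have [q H qv] := sat uv nuv.
apply: leq_trans (ham_path_nonadj H) _; rewrite qv.
apply/subset_leq_card/fintype.subsetP => x; rewrite !inE => /andP[xv nvx].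
by apply: zm; rewrite // esym.
Qed.

End Saturated.

End Counting.

(** * Saturated graphs *)

Section Saturation.
Variables (V : finType) (M : {set {set V}}).
Hypothesis cardV : 2 < #|V|.
Implicit Types (p q : seq V) (u v w x y a b : V) (e : rel V).

Definition add_edge e u v : rel V :=
  fun x y => e x y || (x == u) && (y == v) || (x == v) && (y == u).

Lemma path_add_edge e u v x p :
  u \notin x :: p -> path (add_edge e u v) x p -> path e x p.
Proof.
elim: p x => //= y p IH x; rewrite !inE !negb_or => /and3P[ux uy up].
rewrite /add_edge (eq_sym x u) (negbTE ux) (eq_sym y u) (negbTE uy) andbF !orbF.
by move=> /andP[-> /IH]; apply; rewrite inE negb_or uy.
Qed.

Lemma mem_pedges_rot x t u d E :
  (E \in pedges (x :: t ++ u :: rcons d x)) =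
  (E \in pedges (u :: d ++ x :: rcons t u)).
Proof. by rewrite -cat_cons pedges_cat -[in RHS]cat_cons [in RHS]pedges_cat !mem_cat orbC. Qed.

(** On the cycle started at [u], the new edge can only be the first or the last one, and deleting it
    leaves the path. If it is neither, the cycle already lies in [e]. *)
Lemma ham_path_of_add_edge e u v :
  symmetric e -> (forall x y, [set x; y] \in M -> e x y) ->
  u != v -> ~~ e u v -> ~ ham_cycle e M -> ham_cycle (add_edge e u v) M ->
  exists2 q, ham_path e M (u :: q) & last u q = v.
Proof.
move=> esym eM uv nuv nocyc [x [q0 [P0 U0 A0 S0]]].
have uvM : [set u; v] \notin M by apply: contra nuv => /eM.
have [i p Ei] := rot_to (A0 u).
have {P0 U0 A0 S0} [q [P U A S]] : exists q, [/\ path (add_edge e u v) u (rcons q u),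
    uniq (u :: q), forall y, y \in u :: q & {subset M <= pedges (u :: rcons q u)}].
  exists p; rewrite -Ei rot_uniq; split=> //.
  - by have := P0; rewrite -/(cycle _ (x :: q0)) -(rot_cycle i) Ei.
  - by move=> y; rewrite mem_rot.
  move=> E /S0; move: Ei; rewrite /rot.
  case: (drop i _) (cat_take_drop i (x :: q0)) => [|b d]; case: (take i _) => [|c t] //.
  - by rewrite cats0 => -[-> ->] [-> ->].
  - by move=> [-> ->]; rewrite cats0 => -[-> ->].
  - by move=> [-> <-] [-> <-]; rewrite !rcons_cat mem_pedges_rot.
have sq : 2 < size (u :: q).
  by rewrite -(card_uniqP U) (eq_card (_ : _ =i V)) // => y; rewrite A.
case: q P U A S sq => [|b q] // P U A S sq.
have un : u \notin b :: q by case/andP: U.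
have vq : v \in b :: q by have := A v; rewrite inE eq_sym (negbTE uv).
move: P; rewrite rcons_path => /andP[/= /andP[Pub Pq] Plu].
have {}Pq := path_add_edge un Pq.
have lu : last b q != u by apply: contraNneq un => <-; rewrite mem_last.
have bu : b != u by apply: contraNneq un => <-; rewrite mem_head.
have {}Pub : e u b || (b == v).
  by move: Pub; rewrite /add_edge eqxx (negbTE bu) andbF orbF.
have {}Plu : e (last b q) u || (last b q == v).
  by move: Plu; rewrite /add_edge eqxx (negbTE lu) andbT orbF.
have rM E : E \in M -> E \in pedges (u :: b :: q) \/ E = [set last b q; u].
  move=> /S; rewrite -[u :: _]/(rcons (u :: b :: q) u) (lastI u).
  rewrite pedges_rcons mem_rcons inE => /orP[/eqP->|]; first by right.
  by rewrite -lastI; left.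
(* New edge first: what remains runs from [v] to [u] and is reversed. With at least three vertices
   the closing edge is then an old one. *)
have [bv|nbv] := eqVneq b v.
  have {}Plu : e (last b q) u.
    case/orP: Plu => // /eqP lv; case: q {Pq A S lu rM} U sq un vq lv => // c q U _ _ _ lv.
    by move: U; rewrite /= -[b \in _]/(b \in c :: q) bv -lv /= mem_last /= ?andbF.
  exists (rev (b :: q)); last by rewrite rev_cons last_rcons.
  rewrite -rev_rcons; split.
  - by rewrite sorted_esym //= rcons_path Pq.
  - by rewrite rev_uniq rcons_uniq.
  - by move=> y; rewrite mem_rev mem_rcons A.
  move=> E EM; rewrite mem_pedges_rev (lastI b) pedges_rcons mem_rcons inE.
  case: (rM _ EM) => [|->]; last by rewrite eqxx.
  rewrite pedges_cons inE => /orP[/eqP EE|]; first by move: EM; rewrite EE bv (negbTE uvM).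
  by rewrite -lastI => ->; rewrite orbT.
rewrite (negbTE nbv) orbF in Pub.
have [lv|nlv] := eqVneq (last b q) v.
  exists (b :: q) => //; split=> //; first by rewrite /= Pub.
  move=> E EM; case: (rM _ EM) => // EE.
  by move: EM; rewrite EE lv finset.setUC (negbTE uvM).
case: nocyc; exists u, (b :: q); split=> //.
rewrite (negbTE nlv) orbF in Plu.
by rewrite rcons_path /= Pub Pq.
Qed.

(** Missing edges are added while no Hamilton cycle appears, by induction on a bound for the number
    of nonadjacent ordered pairs. *)
Lemma saturated_extension e0 : symmetric e0 -> irreflexive e0 -> ~ ham_cycle e0 M ->
  exists e : rel V, [/\ symmetric e, irreflexive e, subrel e0 e, ~ ham_cycle e M &
    forall u v, u != v -> ~~ e u v -> ham_cycle (add_edge e u v) M].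
Proof.
move: {2}(#|_|) (leqnn #|[set z : V * V | ~~ e0 z.1 z.2]|) => n.
elim: n e0 => [|n IH] e0 Hn es ei nc.
all: have [Hs|] := EM (forall u v, u != v -> ~~ e0 u v -> ham_cycle (add_edge e0 u v) M);
  first by exists e0; split.
all: move=> /existsNP[u] /existsNP[v] /not_implyP[uv] /not_implyP[nuv nh].
  move: Hn; rewrite leqn0 cards_eq0 => /eqP/setP/(_ (u, v)).
  by rewrite !inE nuv.
have [||||e [h1 h2 h3 h4 h5]] := IH (add_edge e0 u v).
- rewrite -ltnS; apply: leq_trans Hn; apply/proper_card/properP; split.
    by apply/fintype.subsetP => z; rewrite !inE /add_edge !negb_or => /andP[/andP[]].
  by exists (u, v); rewrite !inE //= /add_edge !eqxx orbT.
- by move=> x y; rewrite /add_edge es -orbA -[RHS]orbA; congr orb; rewrite orbC ![(y == _) && _]andbC.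
- move=> x; rewrite /add_edge ei /= [(x == v) && _]andbC orbb.
  by apply/negbTE; apply: contra uv => /andP[/eqP<-].
- exact: nh.
by exists e; split=> // x y xy; apply: h3; rewrite /add_edge xy.
Qed.

Lemma path_neq x p : uniq (x :: p) -> path (fun y z => y != z) x p.
Proof.
elim: p x => //= y p IH x /andP[]; rewrite inE negb_or => /andP[-> _] /=; exact: IH.
Qed.

(** The vertices missing from [p] are appended in any order. In the application [p] concatenates the
    paths of a system; the links between them are harmless in a complete graph. *)
Lemma complete_ham_cycle e p : (forall x y, x != y -> e x y) -> uniq p ->
  {subset M <= pedges p} -> ham_cycle e M.
Proof.
move=> comp Up S; pose c := p ++ [seq x <- enum V | x \notin p].
have cA x : x \in c by rewrite mem_cat mem_filter mem_enum /= andbT orbN.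
have cU : uniq c.
  rewrite cat_uniq Up filter_uniq ?enum_uniq // andbT /=.
  by apply/hasPn => x; rewrite mem_filter => /andP[].
have cS : {subset M <= pedges c} by move=> E /S; exact: mem_pedges_catl.
have csz : 2 < size c.
  by rewrite -(card_uniqP cU) (eq_card (_ : _ =i V)) // => y; rewrite cA.
case: c cA cU cS csz => // x q cA cU cS csz; exists x, q; split=> //.
- rewrite rcons_path (sub_path (comp)) ?path_neq //=; apply: comp.
  apply: contraTneq (csz) => lx; case: q {cA cS csz} cU lx => // y q cU lx.
  by move: cU => /andP[/negP[]]; rewrite -[X in X \in _]lx; exact: (mem_last y q).
- by move=> E /cS; rewrite -rcons_cons -cats1; apply: mem_pedges_catl.
Qed.

End Saturation.

(** * Graphs that are a clique outside a set of small vertices *)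

Section CliqueComplement.
Variables (V : finType) (e : rel V) (M : {set {set V}}) (k : nat) (S : {set V}) (v : V).
Hypothesis esym : symmetric e.
Hypothesis eirr : irreflexive e.
Hypothesis cardM : #|M| <= k.
Hypothesis nocyc : ~ ham_cycle e M.
Hypothesis path_to_v : forall u, u != v -> ~~ e u v ->
  exists2 q, ham_path e M (u :: q) & last u q = v.
Hypothesis clique : forall x y, x \notin S -> y \notin S -> x != y -> e x y.
Hypothesis degS : forall w, w \in S -> deg e w = #|S| + k.
Hypothesis vS : v \notin S.
Hypothesis vN : forall w, w \in S -> ~~ e v w.
Implicit Types (p q : seq V) (u w x y a b : V).

Let neq_v u : u \in S -> u != v. Proof. by apply: contraTneq => ->. Qed.

Let e_v x : e v x = (x \notin S) && (x != v).
Proof.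
have [xS|xS] /= := boolP (x \in S); first by rewrite (negbTE (vN xS)).
by have [->|xv] := eqVneq x v; rewrite ?eirr // clique // eq_sym.
Qed.

Let deg_v : deg e v = #|V|.-1 - #|S|.
Proof.
rewrite /deg (eq_card (_ : _ =i ~: S :\ v)); last by move=> x; rewrite !inE e_v andbC.
by have := cardsC S; have := cardsD1 v (~: S); rewrite inE vS /=; lia.
Qed.

(** The degrees of [u] and [v] add up to exactly the Ore bound, so [ham_path_tight] applies, and [a]
    is adjacent to [v] precisely when it lies outside [S]. *)
Let ham_path_edge u q p1 a b p2 : u \in S -> ham_path e M (u :: q) -> last u q = v ->
  u :: q = p1 ++ a :: b :: p2 ->
  (e u b || (a \notin S)) /\ ([set a; b] \in M) = e u b && (a \notin S).
Proof.
move=> uS H qv E; have [U _] : uniq (u :: q) /\ True by case: H.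
have av : a != v by rewrite -qv; exact: split_neq_last E.
have := ham_path_tight esym eirr cardM nocyc H _ E; rewrite qv e_v av andbT; apply.
rewrite degS // deg_v; have := max_card (mem (v |: S)); rewrite cardsU1 vS; lia.
Qed.

(** Tightness is used on a path starting at [w] itself: an edge of [M] traversed as [c d] has [d]
    adjacent to [w] and [c] outside [S], so [w] is neither of them. *)
Let M_avoids_S a w : w \in S -> [set a; w] \notin M.
Proof.
move=> wS; apply/negP => awM.
have [q H qv] := path_to_v (neq_v wS) (etrans (f_equal negb (esym w v)) (vN wS)).
have [_ _ _ /(_ _ awM)/pedgesP[p1 [c [d [p2 [E cd]]]]]] := H.
have [_] := ham_path_edge wS H qv E; rewrite -cd awM => Ed.
have /andP[ewd cS] : e w d && (c \notin S) by rewrite -Ed.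
case: (set2_eqP cd) => -[_ wE]; first by rewrite -wE eirr in ewd.
by rewrite -wE wS in cS.
Qed.

Let M_avoids_S' a w : w \in S -> [set w; a] \notin M.
Proof. by rewrite finset.setUC; exact: M_avoids_S. Qed.

(* If [x] is outside [S], move [u] between [y] and the successor of [y], which is
   also a neighbour of [u], and close the path through [v] and [x]. *)
Let second_in_S u x q : u \in S -> ham_path e M [:: u, x & q] -> last x q = v ->
  (exists2 y, y \in S & e u y) -> x \in S.
Proof.
move=> uS H qv [y yS uy]; apply/negPn/negP => xS.
have [Sp U A SM] := H.
have yu : y != u by apply: contraTneq uy => ->; rewrite eirr.
have yx : y != x by apply: contraTneq yS => ->.
have yq : y \in q by have := A y; rewrite !inE (negbTE yu) (negbTE yx).
case/splitPr: yq H qv Sp U A SM => p1 p2; case: p2 => [|c p2] H qv Sp U A SM.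
  by move: (neq_v yS); rewrite -qv last_cat /= eqxx.
have [uc _] := @ham_path_edge u _ [:: u, x & p1] y c p2 uS H qv erefl.
rewrite yS orbF in uc.
have H' : ham_path e M (x :: p1 ++ [:: y, u, c & p2]).
  apply: (ham_path_perm H).
  - apply/permP => f; rewrite /= !count_cat /=; ring.
  - have := Sp; rewrite -[_ :: _]/((u :: x :: p1) ++ [:: y, c & p2]) sorted_split.
    move=> /and3P[Sp1 _ Sp2]; have {}Sp1 : path e x (rcons p1 y) by case/andP: Sp1.
    by rewrite -cat_cons sorted_split /= Sp1 esym uy uc.
  - move=> E EM.
    have nE a b : a \in S -> (E == [set a; b]) = false.
      by move=> aS; apply: contraTF EM => /eqP->; exact: M_avoids_S'.
    rewrite (pedges_cons u x) inE (nE u) // orFb -!cat_cons !mem_pedges_split.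
    by rewrite (pedges_cons u c) inE !nE.
apply: nocyc; apply: (ham_path_close H').
by rewrite -[last _ _]/(last u [:: x & p1 ++ [:: y, u, c & p2]]) /= last_cat /=;
   move: qv; rewrite /= last_cat /= => ->; rewrite e_v xS; apply: contraTneq uS => xv;
   move: Sp; rewrite /= xv => /andP[uv _]; move: (contraL (@vN u)); rewrite esym uv => /(_ isT).
Qed.

(* On a Hamilton path from [u] to [v], [w] comes after some [a] outside [S] and
   before a neighbour [b] of [u].  If [b] is in [S], rotating the path to start
   at [w] makes the second vertex of the original path lie outside [S], against
   [second_in_S].  Otherwise [w] sits between two vertices outside [S], also
   after the path is rotated to start at the [S]-neighbour [y] of [w], which the
   tightness condition forbids. *)
Lemma no_mixed_pair u w : u \in S -> w \in S -> u != w -> ~~ e u w ->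
  (exists2 y, y \in S & e u y) -> (exists2 y, y \in S & e w y) -> False.
Proof.
move=> uS wS uw nuw uN [y yS wy].
have [q H qv] := path_to_v (neq_v uS) (etrans (f_equal negb (esym u v)) (vN uS)).
have [Sp U A SM] := H.
have wq : w \in q by have := A w; rewrite inE eq_sym (negbTE uw).
case/splitPr: wq H qv Sp U A SM => q1 [|b q3] H qv Sp U A SM.
  by move: (neq_v wS); rewrite -qv last_cat /= eqxx.
case/lastP: q1 H qv Sp U A SM => [|q1 a].
  by move=> _ _ /=; rewrite (negbTE nuw).
rewrite cat_rcons => H qv Sp U A SM.
have aS : a \notin S.
  by have [+ _] := @ham_path_edge u _ (u :: q1) a w _ uS H qv erefl; rewrite (negbTE nuw).
have ub : e u b.
  have E : u :: q1 ++ [:: a, w, b & q3] = (u :: rcons q1 a) ++ [:: w, b & q3].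
    by rewrite /= cat_rcons.
  by have [+ _] := @ham_path_edge u _ _ w b _ uS H qv E; rewrite wS orbF.
have qv3 : last b q3 = v by move: qv; rewrite last_cat.
have [bS|bS] := boolP (b \in S).
  have E : u :: q1 ++ [:: a, w, b & q3] = u :: (rcons q1 a) ++ [:: w, b & q3].
    by rewrite cat_rcons.
  have := H; rewrite E => /(ham_path_rotate esym)/(_ ub (M_avoids_S' _ wS)) H'.
  have [x [r Er]] : exists x r, rcons q1 a = x :: r.
    by case: (q1) => [|x r]; [exists a, [::] | exists x, (rcons r a)].
  have xS : x \notin S.
    have := @ham_path_edge w _ (w :: rev r) x u (b :: q3) wS H'.
    rewrite Er rev_cons cat_rcons last_cat /= => /(_ qv3 erefl) [].
    by rewrite esym (negbTE nuw).
  case/negP: xS; apply: (second_in_S (q := r ++ [:: w, b & q3]) uS) => //.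
  - by move: H; rewrite -cat_rcons Er.
  - by move: qv; rewrite -cat_rcons Er /= !last_cat.
have yw : y != w by apply: contraTneq wy => ->; rewrite eirr.
have yu : y != u by apply: contraTneq wy => ->; rewrite esym.
have ya : y != a by apply: contraTneq yS => ->.
have yb : y != b by apply: contraTneq yS => ->.
have : y \in u :: q1 ++ [:: a, w, b & q3] by exact: A.
rewrite inE (negbTE yu) mem_cat !inE (negbTE ya) (negbTE yw) (negbTE yb) /=.
have wy' : e y w by rewrite esym.
(* Rotating to start at [y] reverses only what precedes [y], so [w] is entered from [a] if [y] comes
   before it and from [b] otherwise. Either way tightness puts an edge at [w] into [M]. *)
case/orP => /splitPr yq.
- case: yq H qv => r1 r2 H qv.
  have [c [r3 Er]] : exists c r3, r2 ++ [:: a, w, b & q3] = c :: r3.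
    by case: (r2) => [|c r]; [exists a, [:: w, b & q3] | exists c, (r ++ [:: a, w, b & q3])].
  move: H qv; rewrite -catA cat_cons Er => H qv.
  have [uc _] := @ham_path_edge u _ (u :: r1) y c r3 uS H qv erefl.
  rewrite yS orbF in uc.
  have H' := ham_path_rotate esym H uc (M_avoids_S' _ yS).
  have := @ham_path_edge y _ (y :: rev r1 ++ u :: r2) a w (b :: q3) yS H'.
  rewrite -Er /= -catA cat_cons => /(_ _ erefl) [].
    by rewrite last_cat -cat_cons last_cat.
  by rewrite wy' aS (negbTE (M_avoids_S _ wS)).
case: yq H qv qv3 => r1 [|c r2] H qv qv3.
  by move: (neq_v yS); rewrite -qv3 last_cat /= eqxx.
have E0 : q1 ++ [:: a, w, b & r1 ++ [:: y, c & r2]] = (q1 ++ [:: a, w, b & r1]) ++ [:: y, c & r2].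
  by rewrite -catA.
rewrite E0 in H qv.
have [uc _] := @ham_path_edge u _ (u :: (q1 ++ [:: a, w, b & r1])) y c r2 uS H qv erefl.
rewrite yS orbF in uc.
have H' := ham_path_rotate esym H uc (M_avoids_S' _ yS).
have E1 : y :: rev (q1 ++ [:: a, w, b & r1]) ++ [:: u, c & r2] =
    (y :: rev r1) ++ [:: b, w & (a :: rev q1) ++ [:: u, c & r2]].
  by rewrite rev_cat !rev_cons !cat_rcons /= -!catA.
have := @ham_path_edge y _ (y :: rev r1) b w _ yS H' _ E1.
rewrite last_cat /= => /(_ _) [].
  by move: qv3; rewrite last_cat.
by rewrite wy' bS (negbTE (M_avoids_S _ wS)).
Qed.

End CliqueComplement.

(** * Recognising a join with a disjoint union *)

Section Isomorphism.
Variable G : sgraph.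

(** The embeddings glue to a map from the join. It is injective because adjacent vertices differ, so
    only [g2] and [g3] need separating, and bijective by counting; its inverse is the
    isomorphism. *)
Lemma graph_iso_join3 (G1 G2 G3 : sgraph) (g1 : G1 -> G) (g2 : G2 -> G) (g3 : G3 -> G) :
  injective g1 -> injective g2 -> injective g3 -> (forall y z, g2 y != g3 z) ->
  (forall x y, adj (g1 x) (g1 y) = adj x y) ->
  (forall x y, adj (g2 x) (g2 y) = adj x y) ->
  (forall x y, adj (g3 x) (g3 y) = adj x y) ->
  (forall x y, adj (g1 x) (g2 y)) -> (forall x y, adj (g1 x) (g3 y)) ->
  (forall x y, ~~ adj (g2 x) (g3 y)) -> #|G1| + #|G2| + #|G3| = #|G| ->
  graph_iso G (join G1 (disjoint_union G2 G3)).
Proof.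
move=> i1 i2 i3 n23 a1 a2 a3 a12 a13 a23 c.
pose g (z : join G1 (disjoint_union G2 G3)) : G :=
  match z with inl x => g1 x | inr (inl y) => g2 y | inr (inr z) => g3 z end.
have adj_neq (x y : G) : adj x y -> x != y by apply: contraTneq => ->; rewrite adj_irrefl.
have ginj : injective g.
  move=> [x|[x|x]] [y|[y|y]] //= H; do ?by [rewrite (i1 _ _ H) | rewrite (i2 _ _ H) | rewrite (i3 _ _ H)].
  - by have := adj_neq _ _ (a12 x y); rewrite H eqxx.
  - by have := adj_neq _ _ (a13 x y); rewrite H eqxx.
  - by have := adj_neq _ _ (a12 y x); rewrite H eqxx.
  - by have := n23 x y; rewrite H eqxx.
  - by have := adj_neq _ _ (a13 y x); rewrite H eqxx.
  - by have := n23 y x; rewrite H eqxx.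
have gadj x y : adj (g x) (g y) = adj x y.
  case: x y => [x|[x|x]] [y|[y|y]] //=.
  - by rewrite a12.
  - by rewrite a13.
  - by rewrite adj_sym a12.
  - exact/negbTE.
  - by rewrite adj_sym a13.
  - by rewrite adj_sym; exact/negbTE.
have gbij : bijective g by apply: inj_card_bij; rewrite //= !card_sum addnA c.
case: gbij => f fg gf; exists f; first by exists g.
by move=> x y; rewrite -gadj !gf.
Qed.

Lemma set_embedding (A : {set G}) a : #|A| = a ->
  exists2 g : 'I_a -> G, injective g & forall i, g i \in A.
Proof. by move=> <-; exists enum_val => [i j|i]; [exact: enum_val_inj | exact: enum_valP]. Qed.

Lemma adj_complete s (g : 'I_s -> G) : injective g ->
  (forall i j, g i != g j -> adj (g i) (g j)) ->
  forall x y : complete s, adj (g x) (g y) = adj x y.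
Proof.
move=> gi H x y; rewrite [RHS]/(x != y); have [->|xy] := eqVneq x y; first by rewrite adj_irrefl.
by rewrite H // (inj_eq gi).
Qed.

Lemma graph_iso_join_complete (A B C : {set G}) a b (G3 : sgraph) (g3 : G3 -> G) :
  #|A| = a -> #|B| = b -> #|C| = #|G3| -> a + b + #|C| = #|G| ->
  injective g3 -> (forall i, g3 i \in C) -> (forall x y, adj (g3 x) (g3 y) = adj x y) ->
  {in A &, forall x y, x != y -> adj x y} -> {in B &, forall x y, x != y -> adj x y} ->
  {in A & B, forall x y, adj x y} -> {in A & C, forall x y, adj x y} ->
  {in B & C, forall x y, (x != y) && ~~ adj x y} ->
  graph_iso G (join (complete a) (disjoint_union (complete b) G3)).
Proof.
move=> cA cB cC cG i3 g3C a3 aA aB aAB aAC aBC.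
have [g1 i1 g1A] := set_embedding cA; have [g2 i2 g2B] := set_embedding cB.
apply: (@graph_iso_join3 (complete a) (complete b) G3 g1 g2 g3) => //.
- by move=> y z; have /andP[] := aBC _ _ (g2B y) (g3C z).
- by apply: adj_complete => // i j; apply: aA.
- by apply: adj_complete => // i j; apply: aB.
- by move=> x y; apply: aAB.
- by move=> x y; apply: aAC.
- by move=> y z; have /andP[] := aBC _ _ (g2B y) (g3C z).
- by rewrite !card_ord -cC.
Qed.

End Isomorphism.

(** * Structure of the extremal graphs *)

Section Extremal.
Variables (G : sgraph) (M : {set {set G}}) (k d : nat) (S : {set G}).
Hypothesis cardM : #|M| <= k.
Hypothesis nocyc : ~ ham_cycle (@adj G) M.
Hypothesis sat : forall u v : G, u != v -> ~~ adj u v ->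
  exists2 q, ham_path (@adj G) M (u :: q) & last u q = v.
Hypothesis clique : forall x y : G, x \notin S -> y \notin S -> x != y -> adj x y.
Hypothesis kd : k < d.
Hypothesis cardS : #|S| = d - k.
Hypothesis degS : forall w, w \in S -> degree w = d.
Hypothesis big : 2 * d < #|G|.

Let T := [set z | (z \notin S) && [exists w in S, adj w z]].

(** A vertex [z] of [T] is adjacent to some vertex of [S] and to all other vertices outside [S].
    Since [d = #|S| + k], a missing edge [w z] would exceed the Ore bound by one. *)
Let T_join w z : w \in S -> z \in T -> adj w z.
Proof.
move=> wS; rewrite inE => /andP[zS /existsP[w0 /andP[w0S w0z]]].
apply/negPn/negP => nwz.
have wz : w != z by apply: contraTneq wS => ->.
have := saturated_ore (@adj_sym G) (@adj_irrefl G) cardM nocyc sat wz nwz.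
rewrite /deg -/(degree w) degS //.
have : w0 |: (~: S :\ z) \subset [set x | adj z x].
  apply/fintype.subsetP => x; rewrite !inE => /orP[/eqP->|/andP[xz xS]]; first by rewrite adj_sym.
  by rewrite clique // eq_sym.
move/subset_leq_card; rewrite cardsU1 !inE w0S andbF /=.
have := cardsD1 z (~: S); rewrite inE zS /=; have := cardsC S; have := cardS; have := kd.
by move: #|[set x | _]| #|~: S :\ z| #|~: S| #|S| #|G| => N1 N2 N3 N4 N5; lia.
Qed.

(** Every vertex of [S] has exactly [T] as its neighbours outside [S]; hence the graph induced on
    [S] is regular. *)
Let degree_split w : w \in S -> d = #|T| + #|[set x in S | adj w x]|.
Proof.
move=> wS; rewrite -(degS wS) /degree -(cardsID S) addnC; congr (_ + _).
  apply: eq_card => z; rewrite !inE; case: (boolP (z \in S)) => //= zS.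
  apply/idP/existsP => [wz|[w' /andP[w'S w'z]]]; first by exists w; rewrite wS.
  by apply: T_join => //; rewrite inE zS; apply/existsP; exists w'; rewrite w'S.
by apply: eq_card => z; rewrite !inE andbC.
Qed.

Let B := ~: (S :|: T).

Let TS : [disjoint S & T].
Proof. by rewrite disjoints_subset; apply/fintype.subsetP => z zS; rewrite !inE zS. Qed.

Let cardB : #|B| = #|G| - #|T| - (d - k).
Proof. by have := cardsC (S :|: T); rewrite cardsU disjoint_setI0 // cards0 -/B; lia. Qed.

Let B_S : {in B & S, forall x y, (x != y) && ~~ adj x y}.
Proof.
move=> x y; rewrite !inE !negb_or => /andP[xS]; rewrite xS /= => /existsP H yS.
apply/andP; split; first by apply: contraNneq xS => ->.
by apply/negP => xy; apply: H; exists y; rewrite yS adj_sym.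
Qed.

Let T_notin z : z \in T -> z \notin S. Proof. by rewrite inE => /andP[]. Qed.
Let B_notin z : z \in B -> z \notin S. Proof. by rewrite !inE negb_or => /andP[]. Qed.

Let iso (G3 : sgraph) (g3 : G3 -> G) a b : #|T| = a -> #|G| - #|T| - (d - k) = b ->
  #|G3| = d - k -> a <= d ->
  injective g3 -> (forall i, g3 i \in S) -> (forall x y, adj (g3 x) (g3 y) = adj x y) ->
  graph_iso G (join (complete a) (disjoint_union (complete b) G3)).
Proof.
move=> Ta Bb c3 ad i3 g3S a3.
apply: (@graph_iso_join_complete G T B S a b G3 g3) => //.
- by rewrite cardB.
- by rewrite cardS.
- by rewrite cardS; lia.
- by move=> x y /T_notin xS /T_notin yS; apply: clique.
- by move=> x y /B_notin xS /B_notin yS; apply: clique.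
- move=> x y xT yB; apply: clique; [exact: T_notin|exact: B_notin|].
  by apply/eqP => xy; move: yB; rewrite -xy finset.in_setC in_setU xT orbT.
- by move=> x y xT yS; rewrite adj_sym; apply: T_join.
Qed.

(** If [S] is a clique, its inner degree [d - k - 1] leaves [#|T| = k + 1], which gives [L_graph].
    Otherwise an edge inside [S] would, by regularity, give every vertex of [S] a neighbour in [S],
    against [no_mixed_pair]; so [S] is independent and [#|T| = d], which gives [H_graph]. *)
Lemma extremal_graph_iso : graph_iso G (H_graph #|G| k d) \/ graph_iso G (L_graph #|G| k d).
Proof.
have [g gi gS] := set_embedding cardS.
have [w0 w0S] : exists w, w \in S by apply/set0Pn; rewrite -card_gt0 cardS; lia.
have [[u [w [uS wS uw nuw]]]|noP] :=
    EM (exists u w, [/\ u \in S, w \in S, u != w & ~~ adj u w]); [left|right]; last first.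
  have Sc : {in S &, forall x y, x != y -> adj x y}.
    by move=> x y xS yS xy; apply/negPn/negP => nxy; apply: noP; exists x, y.
  have cT : #|T| = k.+1.
    have := degree_split w0S; rewrite (_ : #|[set x in S | adj w0 x]| = #|S :\ w0|); last first.
      apply: eq_card => x; rewrite !inE; case: (boolP (x \in S)) => xS; rewrite ?andbF ?andbT //=.
      by have [->|xw] := eqVneq x w0; rewrite ?adj_irrefl // Sc // eq_sym.
    have := cardsD1 w0 S; rewrite w0S cardS; lia.
  apply: (@iso (complete (d - k)) g) => //; [by rewrite cT; lia|exact: card_ord|].
  by apply: adj_complete => // i j; apply: Sc.
(* [S] and [T] have at most [d] vertices each, and [2 * d < #|G|]. *)
have [v vB] : exists v, v \in B.
  apply/set0Pn; rewrite -card_gt0 cardB; have := degree_split w0S; lia.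
have mixed x y : x \in S -> y \in S -> #|[set z in S | adj x z]| = #|[set z in S | adj y z]|.
  by move=> xS yS; apply/(@addnI #|T|); rewrite -!degree_split.
have Si x y : x \in S -> y \in S -> ~~ adj x y.
  move=> xS yS; apply/negP => xy.
  have H z : z \in S -> exists2 y, y \in S & adj z y.
    move=> zS; have : 0 < #|[set y in S | adj z y]|.
      by rewrite (mixed z x) // card_gt0; apply/set0Pn; exists y; rewrite inE yS.
    by rewrite card_gt0 => /set0Pn[t]; rewrite inE => /andP[]; exists t.
  apply: (@no_mixed_pair G (@adj G) M k S v (@adj_sym G) (@adj_irrefl G) cardM nocyc
            _ clique _ _ _ u w uS wS uw nuw).
  - by move=> *; apply: sat.
  - by move=> z zS; rewrite /deg -/(degree z) degS // cardS subnK // ltnW.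
  - exact: B_notin.
  - by move=> z zS; have /andP[] := B_S vB zS.
  - exact: H.
  - exact: H.
have cT : #|T| = d.
  have := degree_split w0S; rewrite (_ : #|[set x in S | adj w0 x]| = 0) ?addn0 //.
  by apply: eq_card0 => x; rewrite !inE; case: (boolP (x \in S)) => //= xS; apply/negbTE/Si.
apply: (@iso (edgeless (d - k)) g) => //; [by rewrite cT; lia|exact: card_ord|].
by move=> x y; apply/negbTE/Si.
Qed.

End Extremal.

(** * Minimum degree, and path systems as sets of forced edges *)

Lemma min_degree_le (G : sgraph) (x : G) : min_degree G <= degree x.
Proof.
rewrite /min_degree; have := mem_index_enum x; elim: (index_enum G) => // y r IH.
rewrite in_cons big_cons => /orP[/eqP->|/IH]; first exact: geq_minl.
exact/leq_trans/geq_minr.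
Qed.

Lemma subset_of_card (T : finType) (A : {set T}) m : m <= #|A| ->
  exists2 B : {set T}, B \subset A & #|B| = m.
Proof.
move=> mA; exists [set x in take m (enum A)].
  by apply/fintype.subsetP => x; rewrite inE => /mem_take; rewrite mem_enum.
rewrite cardsE (card_uniqP _) ?size_takel -?cardE //.
by rewrite take_uniq // enum_uniq.
Qed.

Section ForcedEdges.
Variables (G : sgraph) (P : seq (seq G)).
Hypothesis PS : path_system P.

Definition forced_edges : {set {set G}} :=
  [set E in flatten [seq path_edges p | p <- P]].

Lemma forced_edgesP E : reflect (exists2 p, p \in P & E \in path_edges p) (E \in forced_edges).
Proof. by rewrite inE; apply/flatten_mapP. Qed.

Lemma card_forced_edges : #|forced_edges| <= nb_edges P.
Proof.
rewrite cardsE; apply: leq_trans (card_size _) _.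
rewrite size_flatten /shape -map_comp sumnE big_map /nb_edges.
by apply: leq_sum => p _; rewrite /= size_map size_zip size_behead geq_minr.
Qed.

Lemma forced_edges_adj x y : [set x; y] \in forced_edges -> adj x y.
Proof.
move=> /forced_edgesP[p pP]; rewrite -[path_edges p]/(pedges p).
move=> /pedgesP[p1 [a [b [p2 [Ep /set2_eqP E]]]]].
have : sorted (@adj G) p by case/andP: PS => /allP/(_ _ pP)/andP[].
rewrite Ep sorted_split => /and3P[_ ab _].
by case: E => -[-> ->]; rewrite // adj_sym.
Qed.

Lemma forced_edges_sub : {subset forced_edges <= pedges (flatten P)}.
Proof.
move=> E /forced_edgesP[p pP Ep]; case/splitPr: pP => P1 P2.
rewrite flatten_cat /=; apply: mem_pedges_catr; exact: mem_pedges_catl.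
Qed.

Lemma ham_cycle_forced_edges : 2 < #|G| -> ham_cycle (@adj G) forced_edges ->
  exists2 c : seq G, hamilton_cycle c &
    forall p, p \in P -> {subset path_edges p <= cycle_edges c}.
Proof.
move=> cG [x [q [Pq U A S]]]; exists (x :: q).
  rewrite /hamilton_cycle U; apply/and4P; split=> //; last exact/forallP.
  by rewrite -(card_uniqP U) (eq_card (_ : _ =i G)) // => y; rewrite A.
move=> p pP E Ep; have /S : E \in forced_edges by apply/forced_edgesP; exists p.
rewrite -[x :: _]/(rcons (x :: q) x) (lastI x) pedges_rcons mem_rcons inE -lastI.
case/orP => [/eqP->|/pedgesP[p1 [a [b [p2 [E1 ->]]]]]]; apply/imsetP.
  by exists (last x q); rewrite ?next_last ?A.
by exists a; rewrite ?A // E1 next_split // -E1.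
Qed.

End ForcedEdges.

(** * Upper bounds on the spectral radius *)

Import Order.TTheory GRing.Theory Num.Theory.
Local Open Scope ring_scope.

Section Spectral.
Variables (R : realType) (G : sgraph).
Implicit Types (S T : {set G}) (x y z u v w : G).

(* Compare an eigenvector [v] with [f] at the index where [|v| / f] is largest. *)
Lemma spectral_radius_lt (f : G -> R) (c : R) : (0 < #|G|)%N ->
  (forall x, 0 < f x) -> (forall x, \sum_(z | adj x z) f z < c * f x) ->
  spectral_radius R G < c.
Proof.
move=> /card_gt0P[x0 _] f0 fc.
(* A supremum preserves only weak inequalities, so the eigenvalues are bounded by the largest ratio
   [r x1], itself below [c]. *)
pose r x := (\sum_(z | adj x z) f z) / f x.
have [x1 _ rmax] : exists2 x1, true & forall x, r x <= r x1.
  by case: (arg_maxP r (i0 := x0) (P := xpredT)) => // x1 _ H; exists x1 => // x; exact: H.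
have sum_le x : \sum_(z | adj x z) f z <= r x1 * f x by rewrite -ler_pdivrMr //; exact: rmax.
have r1c : r x1 < c by rewrite ltr_pdivrMr.
have r10 : 0 <= r x1 by apply: divr_ge0; rewrite ?sumr_ge0 ?(ltW (f0 _)) // => z _; exact: ltW.
apply: le_lt_trans r1c; rewrite /spectral_radius.
(* An empty set of eigenvalues would have supremum 0 by default, which [r10] covers. *)
set E := (X in sup X); have [->|/classical_sets.set0P E0] := eqVneq E classical_sets.set0; first by rewrite sup0.
apply: ge_sup => // a /= /eigenvalueP[v vA v0].
apply: le_trans (ler_norm a) _.
pose g (i : 'I_#|G|) := `|v 0 i| / f (enum_val i).
have [i1 _ gmax] : exists2 i1, true & forall i, g i <= g i1.
  by case: (arg_maxP g (i0 := enum_rank x0) (P := xpredT)) => // i1 _ H; exists i1 => // x; exact: H.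
have v_le i : `|v 0 i| <= g i1 * f (enum_val i).
  by rewrite -ler_pdivrMr //; exact: gmax.
have v1 : 0 < `|v 0 i1|.
  rewrite normr_gt0; apply: contraNneq v0 => v1; apply/eqP/rowP => i; rewrite mxE.
  by apply/eqP; rewrite -normr_le0; apply: le_trans (v_le i) _; rewrite /g v1 normr0 !mul0r.
have g0 : 0 <= g i1 by rewrite divr_ge0 ?ltW.
rewrite -(ler_pM2r v1) -normrM.
have -> : a * v 0 i1 = (v *m adjmx R G) 0 i1 by rewrite vA mxE.
rewrite mxE; apply: le_trans (ler_norm_sum _ _ _) _.
have -> : r x1 * `|v 0 i1| = g i1 * (r x1 * f (enum_val i1)).
  by rewrite [RHS]mulrCA /g divfK ?gt_eqF.
apply: le_trans (ler_wpM2l g0 (sum_le _)); rewrite mulr_sumr [leRHS]big_mkcond.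
rewrite [leRHS](reindex (fun i : 'I_#|G| => enum_val i)) /=; last exact/onW_bij/enum_val_bij.
apply: ler_sum => i _; rewrite mxE adj_sym normrM normr_nat.
by case: ifP => _; rewrite ?mulr1 ?mulr0.
Qed.

Lemma sum_adj_le (f : G -> R) x : (forall z, 0 <= f z) ->
  \sum_(z | adj x z) f z <= \sum_z f z - f x.
Proof.
move=> f0; rewrite [X in _ <= X - _](bigD1 x) //= addrAC subrr add0r [leLHS]big_mkcond [leRHS]big_mkcond.
apply: ler_sum => z _; have [->|zx] := eqVneq z x; first by rewrite adj_irrefl.
by rewrite /=; case: ifP.
Qed.

Lemma sum_adj_nonadj_le (f : G -> R) x y : (forall z, 0 <= f z) -> x != y ->
  ~~ adj x y -> \sum_(z | adj x z) f z <= \sum_z f z - f x - f y.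
Proof.
move=> f0 xy nxy; rewrite [X in _ <= X - _ - _](bigD1 x) //= [X in _ <= _ + X - _ - _](bigD1 y) 1?eq_sym //=.
rewrite (_ : _ - _ = \sum_(i | (i != x) && (i != y)) f i); last by ring.
rewrite [leLHS]big_mkcond [leRHS]big_mkcond.
apply: ler_sum => z _; have [->|zx] := eqVneq z x; first by rewrite adj_irrefl.
have [->|zy] := eqVneq z y; first by rewrite (negbTE nxy) andbF.
by rewrite /=; case: ifP.
Qed.

Lemma sum_adj_degree_le (f : G -> R) x (B : R) : (forall z, f z <= B) ->
  \sum_(z | adj x z) f z <= (degree x)%:R * B.
Proof.
move=> fB; rewrite /degree mulr_natl -sumr_const [leLHS]big_mkcond [leRHS]big_mkcond.
by apply: ler_sum => z _; rewrite inE; case: ifP.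
Qed.

Lemma sum_indicator S : \sum_z (z \in S)%:R = #|S|%:R :> R.
Proof. by rewrite -sum1_card natr_sum [RHS]big_mkcond; apply: eq_bigr => z _; case: (z \in S). Qed.

Lemma sum_indicator1 u : \sum_z (z == u)%:R = 1 :> R.
Proof. by rewrite -(eq_bigr _ (fun z _ => congr1 (fun b : bool => b%:R) (in_set1 z u))) sum_indicator cards1. Qed.

(** The test vector is 1 outside [S] and [tau] on [S]. With [c = #|G| - s - 1], the rows in [S] ask
    for [#|S| + k < c * tau] and the others for [#|S| * tau < #|S| - s]; the last hypothesis makes
    this interval for [tau] nonempty, and its midpoint is taken. *)
Lemma spectral_radius_low_degree S (s k : nat) :
  (s < #|S|)%N -> (s + 1 < #|G|)%N -> (forall w, w \in S -> (degree w <= #|S| + k)%N) ->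
  (#|S| * (#|S| + k) < (#|S| - s) * (#|G| - s - 1))%N ->
  spectral_radius R G < #|G|%:R - s%:R - 1.
Proof.
set t := #|S|; set n := #|G| => st sn dS tk.
set c : R := _ - 1.
have c0 : 0 < c by rewrite /c -natrB ?subr_gt0 ?ltr1n; lia.
have t0 : 0 < t%:R :> R by rewrite ltr0n; lia.
have [tau t1 t2] : exists2 tau : R, (t + k)%:R < c * tau & t%:R * tau < t%:R - s%:R.
  have H : t%:R * (t + k)%:R < (t%:R - s%:R) * c.
    have -> : c = (n - s - 1)%:R by rewrite /c -subnDA natrB ?natrD ?opprD ?addrA //; lia.
    by rewrite -natrB 1?ltnW // -!natrM ltr_nat.
  have cP : c * ((t + k)%:R / c) = (t + k)%:R by rewrite mulrC divfK ?gt_eqF.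
  have tQ : t%:R * ((t%:R - s%:R) / t%:R) = t%:R - s%:R :> R by rewrite mulrC divfK ?gt_eqF.
  have cQ : (t + k)%:R < c * ((t%:R - s%:R) / t%:R) by rewrite mulrA ltr_pdivlMr // mulrC [c * _]mulrC.
  have tP : t%:R * ((t + k)%:R / c) < t%:R - s%:R by rewrite mulrA ltr_pdivrMr.
  exists (((t + k)%:R / c + (t%:R - s%:R) / t%:R) / 2); rewrite mulrA mulrDr ?cP ?tQ.
    by rewrite ltr_pdivlMr // mulr_natr mulr2n ltrD2l.
  by rewrite ltr_pdivrMr // mulr_natr mulr2n ltrD2r.
have tau0 : 0 < tau.
  have : 0 < c * tau by apply: le_lt_trans t1; rewrite ler0n.
  by rewrite pmulr_rgt0.
have tau1 : tau < 1.
  have : t%:R * tau < t%:R by apply: lt_le_trans t2 _; rewrite gerBl ler0n.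
  by rewrite gtr_pMr.
pose f z : R := 1 - (z \in S)%:R * (1 - tau).
have f0 z : 0 < f z by rewrite /f; case: (z \in S); rewrite ?mul1r ?mul0r; lra.
have f1 z : f z <= 1 by rewrite /f; case: (z \in S); rewrite ?mul1r ?mul0r; lra.
apply: (@spectral_radius_lt f) => // [|x]; first by rewrite -/n; lia.
have [xS|xS] := boolP (x \in S).
  apply: le_lt_trans (sum_adj_degree_le x f1) _; rewrite mulr1 /f xS mul1r subKr.
  by apply: le_lt_trans t1; rewrite ler_nat; exact: dS.
apply: le_lt_trans (sum_adj_le x (fun z => ltW (f0 z))) _.
rewrite /f sumrB -mulr_suml sum_indicator sumr_const -/n -/t (negbTE xS) mul0r subr0.
rewrite /c; lra.
Qed.

Lemma card_neighbourhood_le S (D : nat) : (forall w, w \in S -> (degree w <= D)%N) ->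
  (#|[set z | [exists w in S, adj w z]]| <= #|S| * D)%N.
Proof.
move=> dS; rewrite -sum_nat_const.
have -> : [set z | [exists w in S, adj w z]] = \bigcup_(w in S) [set z | adj w z].
  apply/setP => z; rewrite inE; apply/existsP/bigcupP => [[w /andP[wS wz]]|[w wS]].
    by exists w; rewrite ?inE.
  by rewrite inE => wz; exists w; rewrite wS.
apply: leq_trans (_ : \sum_(w in S) degree w <= _)%N; last exact: leq_sum.
elim/big_rec2: _ => [|w m A _ IH]; first by rewrite cards0.
by apply: leq_trans (leq_card_setU _ _) _; rewrite leq_add2l.
Qed.

(** With test values near 1 outside [S] and of order [1/c] on [S], the rows outside [S] sum to about
    [c]. The missing edge saves nearly one unit at [u] and [v]; lowering the vector there spends
    half of it and makes the other rows strict. *)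
Lemma spectral_radius_missing_edge S (D : nat) u v : (0 < D)%N ->
  (forall w, w \in S -> (degree w <= D)%N) ->
  u \notin S -> v \notin S -> u != v -> ~~ adj u v ->
  (8 * (#|S| * D + 1) ^ 2 + #|S| + 1 < #|G|)%N ->
  spectral_radius R G < #|G|%:R - #|S|%:R - 1.
Proof.
set s := #|S|; set n := #|G| => D0 dS uS vS uv nuv big.
set c : R := _ - 1.
pose T := [set z | (z \notin S) && [exists w in S, adj w z]].
have Tq : (#|T| <= s * D)%N.
  apply: leq_trans (card_neighbourhood_le dS); apply/subset_leq_card/fintype.subsetP => z.
  by rewrite !inE => /andP[].
pose q : R := (s * D)%:R.
have q0 : 0 <= q by rewrite ler0n.
have cbig : 8 * (q + 1) ^+ 2 < c.
  have : (8 * (s * D + 1) ^ 2 + s + 1)%:R < n%:R :> R by rewrite ltr_nat.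
  rewrite natrD natrD natrM natrX natrD /q /c; lra.
have c0 : 0 < c by apply: le_lt_trans cbig; rewrite mulr_ge0 ?sqr_ge0.
pose h := c^-1.
have ch : c * h = 1 by rewrite mulfV ?gt_eqF.
have h0 : 0 < h by rewrite invr_gt0.
have hbig : 8 * (q + 1) ^+ 2 * h < 1 by rewrite ltr_pdivrMr ?mul1r.
have hq1 : 8 * h < 1 by nra.
have hq2 : 8 * q * h < 1 by nra.
have hq3 : 8 * q ^+ 2 * h < 1 by nra.
(* [c * tau = 2 * D] dominates the rows in [S]; [c * theta = 2 * q * h] is the total weight
   [#|S| * tau] of [S], which a vertex of [T] may see; [c * eta = 1/2] is the half unit spent at [u]
   and [v]. *)
pose tau := 2 * D%:R * h; pose theta := 2 * q * h ^+ 2; pose eta := h / 2.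
have tau0 : 0 < tau by rewrite /tau !mulr_gt0 ?ltr0n.
have theta0 : 0 <= theta by rewrite /theta !mulr_ge0 ?(ltW h0).
have theta1 : theta < 1 by rewrite /theta; nra.
(* Lowering [f] by order [1/c] at [u] and [v] pays for the contribution of [S] to
   the vertices of [T], once these are raised by order [1/c^2]. *)
pose f z : R := 1 - (z \in S)%:R * (1 - tau) - ((z == u)%:R + (z == v)%:R) * eta
                + (z \in T)%:R * theta.
have fS z : z \in S -> f z = tau.
  move=> zS; rewrite /f zS inE zS /= mul0r addr0 mul1r subKr.
  have /negbTE -> : z != u by apply: contraNneq uS => <-.
  have /negbTE -> : z != v by apply: contraNneq vS => <-.
  by rewrite addr0 mul0r subr0.
have fN z : z \notin S -> f z = 1 - ((z == u)%:R + (z == v)%:R) * eta + (z \in T)%:R * theta.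
  by move=> zS; rewrite /f (negbTE zS) mul0r subr0.
have uv_le z : ((z == u)%:R + (z == v)%:R : R) <= 1.
  have [->|zu] := eqVneq z u; first by rewrite (negbTE uv) addr0.
  by case: (z == v); rewrite add0r.
have eta0 : 0 < eta by rewrite divr_gt0.
have T01 z : 0 <= (z \in T)%:R * theta <= theta.
  by case: (z \in T); rewrite ?mul1r ?mul0r ?lexx theta0.
have fN_ge z : z \notin S -> 1 - eta <= f z.
  by move=> zS; rewrite fN //; have := uv_le z; have /andP[] := T01 z; nra.
have tau1 z : z \in S -> tau <= 1.
  move=> zS; have Dq : D%:R <= q by rewrite ler_nat leq_pmull // card_gt0; apply/set0Pn; exists z.
  by have : D%:R * h <= q * h by [rewrite ler_pM2r]; rewrite /tau; lra.
have f0 z : 0 < f z.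
  have [zS|zS] := boolP (z \in S); first by rewrite fS.
  by apply: lt_le_trans (fN_ge _ zS); rewrite /eta; lra.
have f1 z : f z <= 1 + theta.
  have [zS|zS] := boolP (z \in S); first by rewrite fS //; have := tau1 z zS; lra.
  rewrite fN //; have /andP[_] := T01 z.
  have : 0 <= ((z == u)%:R + (z == v)%:R) * eta by rewrite mulr_ge0 ?addr_ge0 ?ler0n // ltW.
  lra.
have sum_f : \sum_z f z = c + 1 + 2 * q * h - h + #|T|%:R * theta.
  rewrite /f big_split sumrB sumrB sumr_const -!mulr_suml big_split !sum_indicator !sum_indicator1 /=.
  rewrite -/n /c /eta /tau /q natrM; lra.
have Th : #|T|%:R * theta <= h / 4.
  have : #|T|%:R * theta <= q * theta by rewrite ler_wpM2r // ler_nat.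
  have : q * theta = (q ^+ 2 * h) * (2 * h) by rewrite /theta; ring.
  nra.
have ch2 : c * eta = 1 / 2 by rewrite /eta mulrA ch.
have at_end x y : x \notin S -> y \notin S -> x != y -> ~~ adj x y ->
    \sum_(z | adj x z) f z < c * f x.
  move=> xS yS xy nxy.
  have := sum_adj_nonadj_le (fun z => ltW (f0 z)) xy nxy.
  rewrite sum_f; have := fN_ge _ xS; have := fN_ge _ yS => fy fx.
  have : c * (1 - eta) <= c * f x by rewrite ler_pM2l.
  rewrite mulrBr mulr1 ch2 /eta in fx fy *; lra.
apply: (@spectral_radius_lt f) => // [|x]; first by apply/card_gt0P; exists u.
have [xS|xS] := boolP (x \in S).
  apply: le_lt_trans (sum_adj_degree_le x f1) _; rewrite fS //.
  have -> : c * tau = 2 * D%:R by rewrite /tau mulrCA ch mulr1.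
  have : (degree x)%:R <= D%:R :> R by rewrite ler_nat dS.
  have : 0 < D%:R :> R by rewrite ltr0n.
  nra.
have [xu|xu] := eqVneq x u; first by rewrite xu; exact: at_end uv nuv.
have [xv|xv] := eqVneq x v.
  by rewrite xv; apply: (at_end v u); rewrite // 1?eq_sym 1?adj_sym.
have fx : f x = 1 + (x \in T)%:R * theta by rewrite fN // (negbTE xu) (negbTE xv) addr0 mul0r subr0.
have [xT|xT] := boolP (x \in T).
  rewrite fx xT mul1r.
  apply: le_lt_trans (sum_adj_le x (fun z => ltW (f0 z))) _.
  rewrite sum_f fx xT mul1r mulrDr mulr1.
  have -> : c * theta = (c * h) * (2 * q * h) by rewrite /theta; ring.
  rewrite ch mul1r.
  lra.
(* A vertex outside [S] and [T] has no neighbour in [S], so [f] may be replaced by 0 on [S]. *)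
pose g z := f z - (z \in S)%:R * tau.
have g0 z : 0 <= g z.
  rewrite /g; have [zS|zS] := boolP (z \in S); first by rewrite fS // mul1r subrr.
  by rewrite mul0r subr0 ltW.
have -> : \sum_(z | adj x z) f z = \sum_(z | adj x z) g z.
  apply: eq_bigr => z xz; rewrite /g.
  rewrite (negbTE (_ : z \notin S)) ?mul0r ?subr0 //.
  apply: contra xT => zS; rewrite inE xS; apply/existsP; exists z.
  by rewrite zS adj_sym.
apply: le_lt_trans (sum_adj_le x g0) _.
rewrite sumrB sum_f -mulr_suml sum_indicator /g fx (negbTE xS) (negbTE xT) !mul0r subr0 addr0 mulr1.
have -> : #|S|%:R * tau = 2 * q * h by rewrite /tau /q natrM; ring.
lra.
Qed.

End Spectral.

(** For [t < 3 * s] the left side is bounded in [s] and [k], and [t - s] is at least 1. For larger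
    [t], [t - s] is at least two thirds of [t], while [t + k] is at most about half of [n]. *)
Lemma low_degree_arith (s t k n : nat) : (s < t)%N -> (t + k + (t + k) < n + k)%N ->
  (3 * s * (3 * s + k) + 4 * s + 3 * k + 10 < n)%N ->
  (t * (t + k) < (t - s) * (n - s - 1))%N.
Proof.
move=> st tn big; have [t3|t3] := ltnP t (3 * s).
  have h : (t * (t + k) <= 3 * s * (3 * s + k))%N by apply: leq_mul; lia.
  have h2 : (1 * (n - s - 1) <= (t - s) * (n - s - 1))%N by rewrite leq_mul2r; lia.
  lia.
have h : (3 * (t * (t + k)) < 2 * t * (n - s - 1))%N.
  by rewrite mulnCA [(2 * t)%N]mulnC -mulnA ltn_pmul2l; lia.
have h2 : (2 * t * (n - s - 1) <= 3 * (t - s) * (n - s - 1))%N by rewrite leq_mul2r; lia.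
by move: h2; rewrite -mulnA; lia.
Qed.

(** * Combining the spectral bounds with the extremal structure *)

Theorem theorem2p1 (k d : nat) (hd : (k + 2 <= d)%N) :
  exists n0 : nat, forall (R : realType) (n : nat) (G : sgraph),
    (n0 <= n)%N -> #|G| = n -> (d <= min_degree G)%N ->
    n%:R - d%:R + k%:R - 1 <= spectral_radius R G ->
    edge_hamiltonian k G \/
    graph_iso G (H_graph n k d) \/ graph_iso G (L_graph n k d).
Proof.
pose s := (d - k)%N.
(* The threshold dominates those of [low_degree_arith], [spectral_radius_missing_edge] and
   [extremal_graph_iso]. *)
exists (3 * s * (3 * s + k) + 8 * (s * d + 1) ^ 2 + 4 * s + 3 * k + 2 * d + 11)%N.
move=> R n G + En; rewrite -En => {n En} big dG lam.
have ds : d = (s + k)%N by rewrite /s; lia.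
have [|/existsNP[P /not_implyP[PS /not_implyP[Pk noc]]]] := EM (edge_hamiltonian k G); [by left|right].
have G3 : (2 < #|G|)%N by lia.
pose M := forced_edges P.
have cardM : (#|M| <= k)%N by exact: leq_trans (card_forced_edges P) Pk.
have noc0 : ~ ham_cycle (@adj G) M.
  by move/(ham_cycle_forced_edges G3).
have [e [esym eirr ae nocyc esat]] := saturated_extension (@adj_sym G) (@adj_irrefl G) noc0.
have eM x y : [set x; y] \in M -> e x y by move=> /(forced_edges_adj PS)/ae.
have sat u v : u != v -> ~~ e u v -> exists2 q, ham_path e M (u :: q) & last u q = v.
  by move=> uv nuv; apply: (ham_path_of_add_edge G3 esym eM uv nuv nocyc); exact: esat.
have deg_le (x : G) : (degree x <= deg e x)%N.
  by apply/subset_leq_card/fintype.subsetP => z; rewrite !inE; exact: ae.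
have degree_ge (x : G) : (d <= degree x)%N by exact: leq_trans dG (min_degree_le x).
have complete_cycle : (forall x y, x != y -> e x y) -> ham_cycle e M.
  by move=> ce; apply: (complete_ham_cycle G3 ce _ (@forced_edges_sub _ P)); case/andP: PS.
have [i [[u0 du0] i2 cardi]] := saturated_posa esym eirr cardM nocyc complete_cycle sat.
have di : (d <= i)%N by rewrite -du0; exact: leq_trans (degree_ge u0) (deg_le u0).
(* Exactly [i - k] vertices are kept, so that the degree bound [i] equals [#|S| + k]. *)
have [S Ssub cardS] := subset_of_card cardi.
have dS w : w \in S -> (deg e w <= i)%N by move/(fintype.subsetP Ssub); rewrite inE.
have dS' w : w \in S -> (degree w <= i)%N by move/dS; exact: leq_trans.
have {}lam : #|G|%:R - s%:R - 1 <= spectral_radius R G.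
  by apply: le_trans lam; rewrite ds natrD; lra.
have Ss : (#|S| <= s)%N.
  rewrite leqNgt; apply/negP => sS; move: lam; rewrite leNgt => /negP; apply.
  apply: (@spectral_radius_low_degree R G S s k) => //; first by lia.
    by move=> w /dS'; rewrite cardS; lia.
  by apply: low_degree_arith => //; lia.
have ei : i = d by rewrite cardS in Ss; lia.
have {}cardS : #|S| = s by rewrite cardS ei.
rewrite {}ei in dS dS' => {i2 cardi di Ssub du0}.
have clique (x y : G) : x \notin S -> y \notin S -> x != y -> adj x y.
  move=> xS yS xy; apply/negPn/negP => nxy; move: lam; rewrite leNgt => /negP; apply.
  by rewrite -cardS; apply: (@spectral_radius_missing_edge R G S d x y) => //; lia.
have degS w : w \in S -> degree w = d by move=> wS; apply/eqP; rewrite eqn_leq dS' // degree_ge.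
(* On [S] degrees are at most [d] in [e] and already [d] in [G], so saturation added no edge at
   [S]. *)
have eS w z : w \in S -> e w z = adj w z.
  move=> wS; have : [set x | adj w x] == [set x | e w x].
    rewrite eqEcard; apply/andP; split; first by apply/fintype.subsetP => x; rewrite !inE; exact: ae.
    by rewrite -[#|[set x | adj w x]|]/(degree w) degS // dS.
  by move/eqP/setP/(_ z); rewrite !inE.
have ee : e = @adj G.
  apply/funext => x; apply/funext => y.
  have [xS|xS] := boolP (x \in S); first exact: eS.
  have [yS|yS] := boolP (y \in S); first by rewrite esym adj_sym eS.
  have [->|xy] := eqVneq x y; first by rewrite eirr adj_irrefl.
  by rewrite clique // (ae _ _ (clique _ _ xS yS xy)).
subst e; apply: (extremal_graph_iso cardM nocyc sat clique) => //; lia.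
Qed.
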